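(* Let $\theta(q,x)=\sum_{j=0}^{\infty}q^{j(j+1)/2}x^j$ and $K^{\dagger}:=\bigcup_{j=1}^{\infty}(2j-1,2j)\subset\mathbb{R}$. For every $a\in K^{\dagger}$, the function $q\mapsto\theta(q,-q^{-a})$, $q\in(0,1)$, is strictly increasing from $-\infty$ (its limit as $q\to0^+$) to $1/2$ (its limit as $q\to1^-$). For each $a\in K^{\dagger}$, there exists a unique point $(q_a,-q_a^{-a})$, $q_a\in(0,1)$, such that $\theta(q_a,-q_a^{-a})=0$. For $a>0$ with $a\notin K^{\dagger}$, there exists no $q_a\in(0,1)$ such that $\theta(q_a,-q_a^{-a})=0$.
   Context: The partial theta function $\theta(q,x)$ is an entire function of $x$ for each fixed $q$ with $|q|<1$. The intervals $(2j-1,2j)$ are open. *)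

(* Defs.v *)
From Stdlib Require Import Reals Lra Lia.
From Coquelicot Require Import Coquelicot.
Open Scope R_scope.

Definition theta_coef (q : R) (j : nat) : R := q ^ (j * (j + 1) / 2).

Definition theta (q x : R) : R := PSeries (theta_coef q) x.

(* [PSeries] is total, with a junk value on divergent series; this shows that
   [theta q] is a genuine entire power series, so no junk value is involved. *)
Lemma theta_CV_radius (q : R) :
  q <> 0 -> Rabs q < 1 -> CV_radius (theta_coef q) = p_infty.
Proof.
intros q0 q1; apply CV_radius_infinite_DAlembert.
- now intros n; apply pow_nonzero.
- apply is_lim_seq_ext with (fun n => Rabs (q ^ S n)).
  + intros n; f_equal; unfold theta_coef.
    replace (S n * (S n + 1) / 2)%nat with (S n + n * (n + 1) / 2)%nat.
    * rewrite pow_add; field; now apply pow_nonzero.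
    * replace (S n * (S n + 1))%nat with (S n * 2 + n * (n + 1))%nat by lia.
      rewrite Nat.div_add_l; lia.
  + apply (proj1 (is_lim_seq_abs_0 _)).
    apply (is_lim_seq_incr_1 (fun n => q ^ n)).
    now apply is_lim_seq_geom.
Qed.

Definition Kdagger (a : R) : Prop :=
  exists j : nat, (1 <= j)%nat /\ 2 * INR j - 1 < a < 2 * INR j.

(* Main.v *)
Require Import Defs.
From Stdlib Require Import Reals Lra Lia Psatz Ranalysis5.
From Coquelicot Require Import Coquelicot.
Open Scope R_scope.

(* Write [psi q a] for [theta q (- q^(-a))] and put [Q = sqrt q], [r = q^(1/2 - a)];
   then [psi q a] is the sum over [m >= 0] of [(- r)^m Q^(m^2)].  The bilateral sum
   [full_theta q a = psi q a + psi q (1 - a) - 1] is, by the Jacobi triple product,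
   the limit of [prod_(j < N) (1 - Q^(2j+1) r) (1 - Q^(2j+1) / r)] divided by a
   q-binomial coefficient, and
   [full_theta q (a + 1) = - q^(-a) full_theta q a].  For [a = n + b], [0 <= b <= 1], this gives
     [psi q a = (-1)^n q^(-c) full_theta q b + (1 - psi q (1 - a))], [c >= 0],
   where [full_theta q b] is nonnegative and nonincreasing in [q].  For even [n] both
   summands are nonnegative and the second is positive; for odd [n] both are
   monotone in [q], once [psi q (1 - a)] is known to be nonincreasing in [q].

   The last point amounts to the monotonicity in [Q] and in [0 <= r <= 1] of the sum of
   [(- r)^m Q^(m^2)].  The finite triple product shows that the coefficients
   [qbinom (2N) (N + m) Q^(m^2)], which tend to [Q^(m^2)] once normalised, are a
   nonnegative combination of the central halves of the even rows of Pascal's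
   triangle, so the required inequalities need only be checked on binomial
   coefficients, where the alternating sums can be rewritten as sums in powers of
   [1 - r] whose signs are visible. *)

(** * Gaussian binomial coefficients *)

(** Given by the q-Pascal recursion and not as a quotient of products, so that [q = 1] is allowed
    and yields the ordinary binomial coefficients. *)
Fixpoint qbinom (q : R) (n k : nat) : R :=
  match n, k with
  | _, O => 1
  | O, S _ => 0
  | S n', S k' => qbinom q n' k' + q ^ k * qbinom q n' k
  end.

Lemma qbinom_0 (q : R) (n : nat) : qbinom q n 0 = 1.
Proof. now destruct n. Qed.

Lemma qbinom_SS (q : R) (n k : nat) :
  qbinom q (S n) (S k) = qbinom q n k + q ^ S k * qbinom q n (S k).
Proof. reflexivity. Qed.

Lemma qbinom_small (q : R) (n k : nat) : (n < k)%nat -> qbinom q n k = 0.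
Proof.
revert k; induction n as [|n IH]; intros [|k] H; try lia; [easy|].
rewrite qbinom_SS, !IH by lia; ring.
Qed.

(** The mirror image of the defining recursion. Comparing the two expansions gives the symmetry and
    the ratio of neighbouring coefficients. *)
Lemma qbinom_SS_r (q : R) (n k : nat) : (k <= n)%nat ->
  qbinom q (S n) (S k) = q ^ (n - k) * qbinom q n k + qbinom q n (S k).
Proof.
revert k; induction n as [|n IH]; intros k H.
- replace k with 0%nat by lia; simpl; ring.
- destruct k as [|k].
  + pose proof (IH 0%nat (Nat.le_0_l n)) as E1.
    pose proof (qbinom_SS q n 0) as E2; pose proof (qbinom_SS q (S n) 0) as E3.
    rewrite !qbinom_0, !Nat.sub_0_r in *; simpl pow in *; nra.
  + pose proof (IH k (le_S_n _ _ H)) as E1.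
    pose proof (qbinom_SS q n k) as E2.
    pose proof (qbinom_SS q n (S k)) as E3.
    assert (E4 : q ^ S (S k) * qbinom q (S n) (S (S k)) =
      q ^ (n - k) * q ^ S k * qbinom q n (S k) + q ^ S (S k) * qbinom q n (S (S k))).
    { destruct (Nat.eq_dec k n) as [->|kn].
      - rewrite (qbinom_small q n (S n)), (qbinom_small q n (S (S n))),
          (qbinom_small q (S n) (S (S n))) by lia; ring.
      - rewrite IH by lia; replace (n - k)%nat with (S (n - S k)) by lia.
        simpl pow; ring. }
    rewrite qbinom_SS, E4, E3, E1; simpl Nat.sub.
    rewrite <- E1, E2; lra.
Qed.

Lemma qbinom_sym (q : R) (n k : nat) :
  (k <= n)%nat -> qbinom q n k = qbinom q n (n - k).
Proof.
revert k; induction n as [|n IH]; intros [|k] H.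
- easy.
- lia.
- rewrite Nat.sub_0_r, qbinom_0; clear H.
  assert (H : qbinom q n n = 1).
  { now rewrite IH, Nat.sub_diag, qbinom_0 by lia. }
  now rewrite qbinom_SS, H, (qbinom_small q n (S n)), Rmult_0_r, Rplus_0_r by lia.
- destruct (Nat.eq_dec k n) as [->|kn].
  + rewrite Nat.sub_diag, qbinom_0, qbinom_SS, (qbinom_small q n (S n)) by lia.
    rewrite (IH n), Nat.sub_diag, qbinom_0 by lia; ring.
  + replace (S n - S k)%nat with (S (n - S k)) by lia.
    rewrite qbinom_SS_r with (k := (n - S k)%nat) by lia.
    rewrite qbinom_SS, (IH k), (IH (S k)) by lia.
    replace (n - (n - S k))%nat with (S k) by lia.
    replace (S (n - S k)) with (n - k)%nat by lia; ring.
Qed.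

Lemma qbinom_ratio (q : R) (n k : nat) : (k <= n)%nat ->
  (1 - q ^ (n - k)) * qbinom q n k = (1 - q ^ S k) * qbinom q n (S k).
Proof.
intros H; pose proof (qbinom_SS q n k) as E1.
pose proof (qbinom_SS_r q n k H) as E2; lra.
Qed.

Lemma qbinom_ge_0 (q : R) (n k : nat) : 0 <= q -> 0 <= qbinom q n k.
Proof.
intros q0; revert k; induction n as [|n IH]; intros [|k]; simpl; try lra.
apply Rplus_le_le_0_compat; [easy|].
apply Rmult_le_pos; [|easy]; apply (pow_le q (S k) q0).
Qed.

Lemma qbinom_ge_1 (q : R) (n k : nat) :
  0 <= q -> (k <= n)%nat -> 1 <= qbinom q n k.
Proof.
intros q0; revert k; induction n as [|n IH]; intros [|k] H; try lia; try (simpl; lra).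
rewrite qbinom_SS.
assert (0 <= q ^ S k * qbinom q n (S k)).
{ apply Rmult_le_pos; [now apply pow_le|now apply qbinom_ge_0]. }
specialize (IH k); assert (1 <= qbinom q n k) by (apply IH; lia); lra.
Qed.

Lemma qbinom_le (q1 q2 : R) (n k : nat) :
  0 <= q1 <= q2 -> qbinom q1 n k <= qbinom q2 n k.
Proof.
intros q12; revert k; induction n as [|n IH]; intros [|k]; try (simpl; lra).
rewrite !qbinom_SS; apply Rplus_le_compat; [easy|].
apply Rmult_le_compat; [apply pow_le; lra|apply qbinom_ge_0; lra| |easy].
now apply pow_incr.
Qed.

Lemma binom_absorb (n k : nat) :
  (INR n + 1 - INR k) * qbinom 1 (S n) k = (INR n + 1) * qbinom 1 n k.
Proof.
revert k; induction n as [|n IH]; intros [|k].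
- simpl; ring.
- destruct k as [|k]; [simpl; ring|].
  rewrite (qbinom_small 1 1), (qbinom_small 1 0) by lia; ring.
- rewrite !qbinom_0; simpl INR; ring.
- rewrite (qbinom_SS 1 (S n) k), (qbinom_SS 1 n k), pow1.
  pose proof (IH k) as E1; pose proof (IH (S k)) as E2.
  pose proof (qbinom_SS 1 n k) as E3; rewrite pow1 in E3.
  rewrite !S_INR in *; nra.
Qed.

(* Right half ([m >= 0]) of the row of coefficients of the finite triple product,
   which is symmetric in [m]; [lap] is multiplication by [z + 2 + 1/z] on such
   halves. *)
Definition gauss_row (Q : R) (N m : nat) : R :=
  qbinom (Q ^ 2) (2 * N) (N + m) * Q ^ (m * m).

Definition lap (p : nat -> R) (m : nat) : R :=
  match m with
  | O => 2 * p 0%nat + 2 * p 1%nat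
  | S k => p k + 2 * p m + p (S m)
  end.

Lemma gauss_row_small (Q : R) (N m : nat) : (N < m)%nat -> gauss_row Q N m = 0.
Proof. intros H; unfold gauss_row; rewrite qbinom_small by lia; ring. Qed.

(** With [t = Q^(2N+1)], the new factor [(1 + t z)(1 + t / z)] of the product is
    [(1 - t)^2 + t (z + 2 + 1/z)]. Both coefficients are nonnegative for [Q >= 0], and at [Q = 1]
    only [lap] survives. *)
Lemma gauss_row_S (Q : R) (N m : nat) :
  gauss_row Q (S N) m =
  (1 - Q ^ (2 * N + 1)) ^ 2 * gauss_row Q N m +
  Q ^ (2 * N + 1) * lap (gauss_row Q N) m.
Proof.
unfold lap; destruct m as [|m]; [|destruct (Nat.le_gt_cases m N) as [mN|mN]].
- unfold gauss_row; set (q := Q ^ 2).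
  replace (2 * S N)%nat with (S (S (2 * N))) by lia.
  replace (S N + 0)%nat with (S N) by lia.
  replace (N + 1)%nat with (S N) by lia; rewrite Nat.add_0_r, qbinom_SS.
  rewrite (qbinom_sym q (S (2 * N)) N) by lia.
  replace (S (2 * N) - N)%nat with (S N) by lia; rewrite qbinom_SS.
  pose proof (qbinom_ratio q (2 * N) N) as E.
  replace (2 * N - N)%nat with N in E by lia; specialize (E ltac:(lia)).
  assert (EQ : Q ^ (2 * N + 1) = Q * q ^ N).
  { unfold q; rewrite <- pow_mult, Nat.add_1_r; simpl; ring. }
  replace (S (2 * N)) with (2 * N + 1)%nat by lia.
  simpl pow in E; simpl (q ^ S N); rewrite EQ.
  set (x := qbinom q (2 * N) N) in *; set (y := qbinom q (2 * N) (S N)) in *.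
  (* The two sides differ by a multiple of the ratio relation [E] at the centre. *)
  apply Rminus_diag_uniq; transitivity
    (q * q ^ N * ((1 - q ^ N) * x - (1 - q * q ^ N) * y)).
  + clear; generalize (q ^ N); clearbody x y; subst q; intros z; simpl; ring.
  + rewrite E; ring.
- pose proof (qbinom_SS_r (Q ^ 2) (S (2 * N)) (N + S m) ltac:(lia)) as E.
  replace (S (2 * N) - (N + S m))%nat with (N - m)%nat in E by lia.
  replace (N + S m)%nat with (S (N + m)) in E by lia.
  rewrite !(qbinom_SS _ (2 * N)) in E.
  unfold gauss_row.
  replace (2 * S N)%nat with (S (S (2 * N))) by lia.
  replace (S N + S m)%nat with (S (S (N + m))) by lia.
  replace (N + S m)%nat with (S (N + m)) by lia.
  replace (N + S (S m))%nat with (S (S (N + m))) by lia.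
  rewrite E; rewrite <- !pow_mult.
  set (x := qbinom _ _ (N + m)); set (y := qbinom _ _ (S (N + m))).
  set (z := qbinom _ _ (S (S (N + m)))).
  replace (Q ^ (2 * (N - m)) * (x + Q ^ (2 * S (N + m)) * y)) with
    (Q ^ (2 * (N - m)) * x + Q ^ (2 * N + 1) * Q ^ (2 * N + 1) * y).
  2:{ rewrite Rmult_plus_distr_l, <- Rmult_assoc, <- !pow_add.
      do 3 f_equal; lia. }
  replace (((1 - Q ^ (2 * N + 1)) ^ 2 * (y * Q ^ (S m * S m)) +
    Q ^ (2 * N + 1) * (x * Q ^ (m * m) + 2 * (y * Q ^ (S m * S m)) +
    z * Q ^ (S (S m) * S (S m))))) with
    ((1 + Q ^ (2 * N + 1) * Q ^ (2 * N + 1)) * y * Q ^ (S m * S m) +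
     Q ^ (2 * N + 1) * Q ^ (m * m) * x +
     Q ^ (2 * N + 1) * Q ^ (S (S m) * S (S m)) * z) by ring.
  rewrite <- !(pow_add Q (2 * N + 1)).
  replace (2 * N + 1 + m * m)%nat with (2 * (N - m) + S m * S m)%nat by nia.
  replace (2 * N + 1 + S (S m) * S (S m))%nat
    with (2 * S (S (N + m)) + S m * S m)%nat by nia.
  rewrite !pow_add; ring.
- rewrite !gauss_row_small by lia; ring.
Qed.

(** * Alternating sums over rows of binomial coefficients *)

(* [sum_n] equations live in Coquelicot's carrier types, on which [ring] fails. *)
Ltac ring_R := match goal with |- @eq _ ?a ?b => change (@eq R a b); ring end.

Lemma sum_n_S (a : nat -> R) (n : nat) : sum_n a (S n) = sum_n a n + a (S n).
Proof. now rewrite sum_Sn. Qed.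

Lemma sum_n_0 (a : nat -> R) : sum_n a 0 = a 0%nat.
Proof. now rewrite sum_O. Qed.

Lemma sum_n_S_l (a : nat -> R) (n : nat) :
  sum_n a (S n) = a 0%nat + sum_n (fun i => a (S i)) n.
Proof.
induction n as [|n IH]; [now rewrite sum_n_S, !sum_n_0|].
rewrite sum_n_S, IH, (sum_n_S (fun i => a (S i))); ring_R.
Qed.

Lemma sum_n_lin (a b : nat -> R) (c d : R) (n : nat) :
  sum_n (fun m => c * a m + d * b m) n = c * sum_n a n + d * sum_n b n.
Proof.
induction n as [|n IH]; [now rewrite !sum_n_0|].
rewrite !sum_n_S, IH; ring_R.
Qed.

Lemma sum_n_ge_0 (a : nat -> R) (n : nat) :
  (forall m, (m <= n)%nat -> 0 <= a m) -> 0 <= sum_n a n.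
Proof.
induction n as [|n IH]; intros H; [rewrite sum_n_0; now apply H|].
rewrite sum_n_S; apply Rplus_le_le_0_compat; [|now apply H].
apply IH; intros m mn; apply H; lia.
Qed.

(** The cone spanned by the half rows of index at most [n] at [Q = 1]. The inductive form lets a
    linear inequality pass from the rows to the cone by induction. *)
Inductive row_cone (n : nat) : (nat -> R) -> Prop :=
| row_cone_row k : (k <= n)%nat -> row_cone n (gauss_row 1 k)
| row_cone_comb p p1 p2 c1 c2 :
    row_cone n p1 -> row_cone n p2 -> 0 <= c1 -> 0 <= c2 ->
    (forall m, p m = c1 * p1 m + c2 * p2 m) -> row_cone n p.

Lemma row_cone_ext (n : nat) (p1 p2 : nat -> R) :
  row_cone n p1 -> (forall m, p2 m = p1 m) -> row_cone n p2.
Proof.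
intros H E; apply (row_cone_comb n p2 p1 p1 1 0); trivial; try lra.
intros m; rewrite E; ring_R.
Qed.

Lemma row_cone_mono (n n' : nat) (p : nat -> R) :
  (n <= n')%nat -> row_cone n p -> row_cone n' p.
Proof.
intros nn'; induction 1 as [k kn|p p1 p2 c1 c2 _ H1 _ H2 c1p c2p E].
- apply row_cone_row; lia.
- now apply (row_cone_comb n' p p1 p2 c1 c2).
Qed.

(** At [Q = 1] the term with [(1 - t)^2] in [gauss_row_S] vanishes, so [lap] sends each generating
    row to the next one. *)
Lemma row_cone_lap (n : nat) (p : nat -> R) :
  row_cone n p -> row_cone (S n) (lap p).
Proof.
induction 1 as [k kn|p p1 p2 c1 c2 _ H1 _ H2 c1p c2p E].
- apply (row_cone_ext _ (gauss_row 1 (S k))); [apply row_cone_row; lia|].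
  intros m; rewrite gauss_row_S, pow1; ring_R.
- apply (row_cone_comb _ _ (lap p1) (lap p2) c1 c2); trivial.
  intros [|m]; simpl; rewrite !E; ring_R.
Qed.

Lemma row_cone_gauss_row (Q : R) (N : nat) : 0 <= Q ->
  row_cone N (gauss_row Q N).
Proof.
intros Q0; induction N as [|N IH].
- apply (row_cone_ext _ (gauss_row 1 0)); [now apply row_cone_row|].
  intros [|m]; [reflexivity|rewrite !gauss_row_small by lia; ring_R].
- apply (row_cone_comb _ _ (gauss_row Q N) (lap (gauss_row Q N))
    ((1 - Q ^ (2 * N + 1)) ^ 2) (Q ^ (2 * N + 1))).
  + apply row_cone_mono with (2 := IH); lia.
  + now apply row_cone_lap.
  + apply pow2_ge_0.
  + now apply pow_le.
  + intros m; apply gauss_row_S.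
Qed.

Lemma row_cone_sum_ge_0 (w p : nat -> R) (n : nat) : row_cone n p ->
  (forall k, (k <= n)%nat -> 0 <= sum_n (fun m => w m * gauss_row 1 k m) n) ->
  0 <= sum_n (fun m => w m * p m) n.
Proof.
intros H Hw; induction H as [k kn|p p1 p2 c1 c2 _ H1 _ H2 c1p c2p E].
- now apply Hw.
- rewrite (sum_n_ext _ (fun m => c1 * (w m * p1 m) + c2 * (w m * p2 m))).
  + rewrite sum_n_lin; apply Rplus_le_le_0_compat; now apply Rmult_le_pos.
  + intros m; rewrite E; ring_R.
Qed.

Lemma gauss_row_1 (N m : nat) : gauss_row 1 N m = qbinom 1 (2 * N) (N + m).
Proof. unfold gauss_row; rewrite !pow1; ring_R. Qed.

(* Binomial transform: by Pascal's rule the sum at level [n + 1] with weights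
   [w] is the one at level [n] with weights [w m + w (m + 1)], plus a boundary
   term. *)
Lemma binom_tail_sum (W : nat -> nat -> R) (n j M : nat) :
  (forall i m, W (S i) m = W i m + W i (S m)) -> (n < S j + M)%nat ->
  sum_n (fun m => W 0%nat m * qbinom 1 (S n) (S j + m)) M =
  sum_n (fun i => W i 0%nat * qbinom 1 (n - i) j) n.
Proof.
intros HW.
assert (step : forall i n, (n < S j + M)%nat ->
  sum_n (fun m => W i m * qbinom 1 (S n) (S j + m)) M =
  W i 0%nat * qbinom 1 n j + sum_n (fun m => W (S i) m * qbinom 1 n (S j + m)) M).
{ clear n; intros i n nM.
  assert (E : forall L, sum_n (fun m => W i m * qbinom 1 (S n) (S j + m)) L =
    W i 0%nat * qbinom 1 n j + sum_n (fun m => W (S i) m * qbinom 1 n (S j + m)) L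
    - W i (S L) * qbinom 1 n (S j + L)).
  { induction L as [|L IH].
    - rewrite !sum_n_0, HW, Nat.add_0_r, qbinom_SS, pow1; ring_R.
    - rewrite !sum_n_S, IH, HW.
      replace (S j + S L)%nat with (S (S j + L)) by lia.
      rewrite qbinom_SS, pow1; ring_R. }
  (* The sum reaches past the end of the row, so the boundary term is zero. *)
  rewrite E, (qbinom_small 1 n (S j + M)) by lia; ring_R. }
assert (gen : forall i, (n < S j + M)%nat ->
  sum_n (fun m => W i m * qbinom 1 (S n) (S j + m)) M =
  sum_n (fun k => W (i + k)%nat 0%nat * qbinom 1 (n - k) j) n); [|apply gen].
induction n as [|n IH]; intros i nM; rewrite step by easy.
- rewrite sum_n_0, Nat.add_0_r.
  rewrite (sum_n_ext _ (fun m => 0 * 0 + 0 * 0)).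
  + rewrite sum_n_lin; simpl; ring_R.
  + intros m; rewrite qbinom_small by lia; ring_R.
- rewrite IH, sum_n_S_l, Nat.add_0_r, Nat.sub_0_r by lia.
  f_equal; apply sum_n_ext; intros k; do 2 f_equal; lia.
Qed.

Lemma row_sum (W : nat -> nat -> R) (k M : nat) :
  (forall i m, W (S i) m = W i m + W i (S m)) -> (S k <= M)%nat ->
  sum_n (fun m => W 0%nat m * gauss_row 1 (S k) m) M =
  sum_n (fun i => W i 0%nat * qbinom 1 (2 * k + 1 - i) k) (2 * k + 1).
Proof.
intros HW kM; rewrite <- (binom_tail_sum W (2 * k + 1) k M HW) by lia.
apply sum_n_ext; intros m; rewrite gauss_row_1.
now replace (2 * S k)%nat with (S (2 * k + 1)) by lia.
Qed.

Lemma row_0_sum (w : nat -> R) (M : nat) :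
  sum_n (fun m => w m * gauss_row 1 0 m) M = w 0%nat.
Proof.
induction M as [|M IH].
- rewrite sum_n_0, gauss_row_1; simpl; ring_R.
- rewrite sum_n_S, IH, gauss_row_small by lia; ring_R.
Qed.

(** The weights [(1 - r)^i (- r)^m] obey the recursion of the binomial transform. For [r <= 1] the
    signs are gone from the transformed sum. *)
Lemma row_alt_sum (r : R) (k M : nat) : (S k <= M)%nat ->
  sum_n (fun m => (- r) ^ m * gauss_row 1 (S k) m) M =
  sum_n (fun i => (1 - r) ^ i * qbinom 1 (2 * k + 1 - i) k) (2 * k + 1).
Proof.
intros kM.
rewrite (sum_n_ext _ (fun m => ((1 - r) ^ 0 * (- r) ^ m) * gauss_row 1 (S k) m))
  by (intros m; simpl; ring_R).
rewrite (row_sum (fun i m => (1 - r) ^ i * (- r) ^ m)); trivial.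
- apply sum_n_ext; intros i; simpl; ring_R.
- intros i m; simpl; ring_R.
Qed.

Lemma row_alt_sum_decr (r1 r2 : R) (k M : nat) :
  0 <= r1 <= r2 -> r2 <= 1 -> (k <= M)%nat ->
  0 <= sum_n (fun m => ((- r1) ^ m - (- r2) ^ m) * gauss_row 1 k m) M.
Proof.
intros r12 r21 kM; destruct k as [|k].
- rewrite row_0_sum; simpl; lra.
- rewrite (sum_n_ext _ (fun m => 1 * ((- r1) ^ m * gauss_row 1 (S k) m) +
    (- 1) * ((- r2) ^ m * gauss_row 1 (S k) m))) by (intros m; ring_R).
  rewrite sum_n_lin, !row_alt_sum, <- sum_n_lin by easy.
  apply sum_n_ge_0; intros i _.
  assert ((1 - r2) ^ i <= (1 - r1) ^ i) by (apply pow_incr; lra).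
  pose proof (qbinom_ge_0 1 (2 * k + 1 - i) k Rle_0_1); nra.
Qed.

(** In the transformed sum the term [i = 0] is exactly half of the central coefficient, and the
    other terms are nonnegative. *)
Lemma row_alt_sum_ge_half (r : R) (k M : nat) : 0 <= r <= 1 -> (k <= M)%nat ->
  gauss_row 1 k 0 <= 2 * sum_n (fun m => (- r) ^ m * gauss_row 1 k m) M.
Proof.
intros r01 kM; destruct k as [|k].
- rewrite row_0_sum; unfold gauss_row; simpl; lra.
- rewrite row_alt_sum, gauss_row_1 by easy.
  replace (2 * k + 1)%nat with (S (2 * k)) by lia.
  rewrite sum_n_S_l, Nat.add_0_r.
  replace (2 * S k)%nat with (S (S (2 * k))) by lia.
  rewrite qbinom_SS, pow1, (qbinom_sym 1 (S (2 * k)) (S k)) by lia.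
  replace (S (2 * k) - S k)%nat with k by lia.
  rewrite Nat.sub_0_r.
  enough (0 <= sum_n (fun i => (1 - r) ^ S i *
    qbinom 1 (S (2 * k) - S i) k) (2 * k)) by (simpl pow in *; lra).
  apply sum_n_ge_0; intros i _; apply Rmult_le_pos; [apply pow_le|apply qbinom_ge_0]; lra.
Qed.

(** Summation by parts, with the terms [(nu i - nu (S i)) * u i] dropped. At [i = 0] the truncated
    [i - 1] is [0], so that summand vanishes. *)
Lemma abel_sum_ge (nu u : nat -> R) (n : nat) :
  (forall i, 0 <= u i) -> u 0%nat = 0 ->
  (forall i, (1 <= i < n)%nat -> nu (S i) <= nu i) ->
  nu n * u n <= sum_n (fun i => nu i * (u i - u (i - 1)%nat)) n.
Proof.
intros u0 u00; induction n as [|n IH]; intros H.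
- rewrite sum_n_0, u00; simpl; rewrite u00; lra.
- rewrite sum_n_S; simpl Nat.sub; rewrite Nat.sub_0_r.
  assert (nu n * u n <= sum_n (fun i => nu i * (u i - u (i - 1)%nat)) n).
  { apply IH; intros i Hi; apply H; lia. }
  assert (nu (S n) * u n <= nu n * u n); [|lra].
  destruct n as [|n]; [rewrite u00; lra|].
  apply Rmult_le_compat_r; [easy|apply H; lia].
Qed.

(** With [e = k - i], absorption reduces the main case to [(i + 1)(e + 1) <= i (2e + i + 1)], whose
    two sides differ by [(i - 1)(e + i + 1)]. *)
Lemma row_weight_decr (k i : nat) : (1 <= i <= 2 * k)%nat ->
  INR (S i) * qbinom 1 (2 * k + 1 - S i) k <= INR i * qbinom 1 (2 * k + 1 - i) k.
Proof.
intros Hi; replace (2 * k + 1 - S i)%nat with (2 * k - i)%nat by lia.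
pose proof (qbinom_ge_0 1 (2 * k + 1 - i) k Rle_0_1) as p.
destruct (Nat.lt_ge_cases (2 * k - i) k) as [small|big].
- rewrite (qbinom_small 1 (2 * k - i)), Rmult_0_r by easy.
  apply Rmult_le_pos; [apply pos_INR|easy].
- set (e := (k - i)%nat).
  pose proof (binom_absorb (2 * k - i) k) as E.
  replace (S (2 * k - i)) with (2 * k + 1 - i)%nat in E by lia.
  pose proof (qbinom_ge_0 1 (2 * k - i) k Rle_0_1) as p'.
  set (x := qbinom 1 (2 * k + 1 - i) k) in *; set (y := qbinom 1 (2 * k - i) k) in *.
  replace (INR (2 * k - i)) with (INR k + INR e) in E
    by (rewrite <- plus_INR; f_equal; lia).
  assert (Ek : INR k = INR e + INR i) by (rewrite <- plus_INR; f_equal; lia).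
  rewrite S_INR, Ek in *.
  assert (0 <= INR e) by apply pos_INR.
  assert (1 <= INR i) by (apply (le_INR 1); lia).
  apply Rmult_le_reg_l with (INR e + 1); [lra|].
  replace ((INR e + 1) * (INR i * x)) with (INR i * ((INR e + 1) * x)) by ring_R.
  replace ((INR e + 1) * x) with ((INR e + INR i + INR e + 1) * y) by lra.
  clear - p' H H0; apply Rminus_le_0.
  replace (_ - _) with (y * (INR e * (INR i - 1) + (INR i - 1) * (INR i + 1))) by ring.
  apply Rmult_le_pos; [easy|].
  apply Rplus_le_le_0_compat; apply Rmult_le_pos; lra.
Qed.

(** The row version of the sign of the derivative in [Q]. The binomial transform turns the sum into
    [- r] times an Abel sum with decreasing weights. *)
Lemma row_alt_sum_sqr_le_0 (r : R) (k M : nat) : 0 <= r <= 1 -> (k <= M)%nat ->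
  sum_n (fun m => (INR m ^ 2 * (- r) ^ m) * gauss_row 1 k m) M <= 0.
Proof.
intros r01 kM; destruct k as [|k]; [rewrite row_0_sum; simpl; lra|].
set (u := fun i => INR i * (1 - r) ^ (i - 1)).
(* [W i m] is [(s d/ds)^2] applied to [s^m (1 + s)^i] at [s = -r]. *)
set (W := fun i m : nat => INR m ^ 2 * (- r) ^ m * (1 - r) ^ i +
  (2 * INR m + 1) * (- r) ^ S m * u i +
  INR i * (- r) ^ S (S m) * u (i - 1)%nat).
assert (HW : forall i m, W (S i) m = W i m + W i (S m)).
{ intros i m; unfold W, u; rewrite !S_INR.
  destruct i as [|[|i]]; simpl Nat.sub; rewrite ?Nat.sub_0_r, ?S_INR; simpl; ring_R. }
rewrite (sum_n_ext _ (fun m => W 0%nat m * gauss_row 1 (S k) m))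
  by (intros m; unfold W, u; simpl; ring_R).
rewrite row_sum by easy.
assert (Hu : forall i, 0 <= u i).
{ intros i; apply Rmult_le_pos; [apply pos_INR|apply pow_le; lra]. }
pose proof (abel_sum_ge (fun i => INR i * qbinom 1 (2 * k + 1 - i) k) u
  (2 * k + 1) Hu ltac:(unfold u; simpl; ring_R)) as A.
(* Here [W i 0 = - r * i * (u i - u (i - 1))]. *)
rewrite (sum_n_ext _ (fun i => (- r) * (INR i * qbinom 1 (2 * k + 1 - i) k *
  (u i - u (i - 1)%nat)) + 0 * 0)).
- rewrite sum_n_lin.
  enough (0 <= sum_n (fun i => INR i * qbinom 1 (2 * k + 1 - i) k *
    (u i - u (i - 1)%nat)) (2 * k + 1)) by nra.
  eapply Rle_trans; [|apply A].
  + apply Rmult_le_pos; [apply Rmult_le_pos|easy]; [apply pos_INR|].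
    apply qbinom_ge_0; lra.
  + intros i Hi; apply row_weight_decr; lia.
- intros i; unfold W, u.
  destruct i as [|[|i]]; simpl Nat.sub; rewrite ?Nat.sub_0_r, ?S_INR; simpl; ring_R.
Qed.

(** * The partial theta series for [0 <= r <= 1] *)

Lemma Series_tail_le (a d : nat -> R) (M : nat) :
  (forall m, Rabs (a m) <= d m) -> ex_series d ->
  Rabs (Series a - sum_n a M) <= Series d - sum_n d M.
Proof.
intros ad dcv.
assert (acv : ex_series a) by now apply (ex_series_le a d).
rewrite (Series_incr_n a (S M)), (Series_incr_n d (S M)) by (trivial; lia).
rewrite !sum_n_Reals; simpl pred.
replace (_ + _ - _) with (Series (fun k => a (S M + k)%nat)) by ring_R.
replace (_ + _ - _) with (Series (fun k => d (S M + k)%nat)) by ring_R.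
assert (dcv' : ex_series (fun k => d (S M + k)%nat)) by now apply ex_series_incr_n.
eapply Rle_trans.
- apply Series_Rabs, (ex_series_le (V := R_CompleteNormedModule) _ (fun k => d (S M + k)%nat)); trivial.
  intros k; unfold norm; simpl; unfold abs; simpl; rewrite Rabs_Rabsolu; apply ad.
- apply Series_le; [|easy]; intros k; split; [apply Rabs_pos|apply ad].
Qed.

Lemma Series_tail_cvg (d : nat -> R) (eps : R) : ex_series d -> 0 < eps ->
  exists M0, forall M, (M0 <= M)%nat -> Series d - sum_n d M < eps.
Proof.
intros dcv eps0.
pose proof (Series_correct d dcv) as H.
destruct (proj1 (filterlim_locally (F := eventually) (sum_n d) (Series d)) H
  (mkposreal eps eps0)) as [M0 HM0].
exists M0; intros M HM; specialize (HM0 M HM).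
apply Rabs_lt_between' in HM0; simpl in HM0; lra.
Qed.

(* Tannery's theorem along an arbitrary filter. *)
Lemma dominated_series {T : Type} (F : (T -> Prop) -> Prop) {FF : Filter F}
  (a : T -> nat -> R) (b d : nat -> R) :
  ex_series d -> (forall m, Rabs (b m) <= d m) ->
  (forall m, filterlim (fun t => a t m) F (locally (b m))) ->
  F (fun t => forall m, Rabs (a t m) <= d m) ->
  filterlim (fun t => Series (a t)) F (locally (Series b)).
Proof.
intros dcv bd ab ad; apply filterlim_locally; intros eps.
destruct (Series_tail_cvg d (eps / 3) dcv) as [M HM].
{ destruct eps; simpl; lra. }
specialize (HM M (Nat.le_refl M)).
assert (fin : filterlim (fun t => sum_n (a t) M) F (locally (sum_n b M))).
{ clear HM; induction M as [|M IH].
  - apply filterlim_ext with (fun t => a t 0%nat); [intros t; now rewrite sum_n_0|].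
    rewrite sum_n_0; apply ab.
  - apply filterlim_ext with (fun t => plus (sum_n (a t) M) (a t (S M))).
    { intros t; now rewrite sum_Sn. }
    rewrite sum_Sn; apply filterlim_comp_2 with (1 := IH) (2 := ab (S M)).
    apply (filterlim_plus (V := R_NormedModule)). }
assert (eps3 : 0 < eps / 3) by (destruct eps; simpl; lra).
pose proof (proj1 (filterlim_locally _ _) fin (mkposreal _ eps3)) as near.
generalize (filter_and _ _ near ad); apply filter_imp; intros t [H1 H2].
pose proof (Series_tail_le (a t) d M H2 dcv) as A.
pose proof (Series_tail_le b d M bd dcv) as B.
apply Rabs_lt_between' in H1; simpl in H1.
apply Rabs_le_between in A; apply Rabs_le_between in B.
apply Rabs_lt_between'; simpl in *; lra.
Qed.

Lemma triangular_double (m : nat) : (2 * (m * (m + 1) / 2) = m + m * m)%nat.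
Proof.
rewrite <- Nat.Lcm0.divide_div_mul_exact, Nat.mul_comm, Nat.div_mul; try lia.
destruct (Nat.Even_or_Odd m) as [[k ->]|[k ->]].
- exists (k * (2 * k + 1))%nat; nia.
- exists ((2 * k + 1) * (k + 1))%nat; nia.
Qed.

(** This is the entire series [theta (Q^2)] at [C / Q], because [m (m + 1) = m + m^2]. *)
Lemma ex_series_gauss (C Q : R) : 0 < Q < 1 ->
  ex_series (fun m => C ^ m * Q ^ (m * m)).
Proof.
intros Q01; assert (Q2 : 0 < Q ^ 2 < 1) by (simpl; nra).
assert (H : ex_pseries (theta_coef (Q ^ 2)) (C / Q)).
{ apply CV_disk_correct.
  apply CV_disk_inside; rewrite theta_CV_radius; [easy|lra|].
  rewrite Rabs_pos_eq; lra. }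
revert H; apply ex_series_ext; intros m; unfold theta_coef.
rewrite pow_n_pow, <- pow_mult.
rewrite triangular_double, pow_add; unfold scal; simpl; unfold mult; simpl.
unfold Rdiv; rewrite Rpow_mult_distr, pow_inv; field.
apply pow_nonzero; lra.
Qed.

(** * Gaussian series as limits of normalised rows *)

Definition gauss_series (w : nat -> R) (Q : R) : R :=
  Series (fun m => w m * Q ^ (m * m)).

Lemma pow_le_1 (q : R) (n : nat) : 0 <= q <= 1 -> 0 <= q ^ n <= 1.
Proof.
intros H; split; [now apply pow_le|].
rewrite <- (pow1 n); now apply pow_incr.
Qed.

(** By [qbinom_ratio] the coefficients decrease away from the centre. The bound supplies the
    domination for the limit in [N]. *)
Lemma qbinom_central_ratio (q : R) (N m : nat) : 0 <= q < 1 ->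
  0 <= qbinom q (2 * N) (N + m) / qbinom q (2 * N) N <= 1.
Proof.
intros q01.
pose proof (qbinom_ge_1 q (2 * N) N ltac:(lra) ltac:(lia)) as c1.
assert (H : 0 <= qbinom q (2 * N) (N + m) <= qbinom q (2 * N) N).
{ split; [apply qbinom_ge_0; lra|].
  induction m as [|m IH]; [rewrite Nat.add_0_r; lra|].
  apply Rle_trans with (2 := IH); rewrite Nat.add_succ_r.
  destruct (Nat.le_gt_cases (N + m) (2 * N)) as [le|gt].
  - pose proof (qbinom_ratio q (2 * N) (N + m) le) as E.
    set (x := qbinom q (2 * N) (N + m)) in *.
    set (y := qbinom q (2 * N) (S (N + m))) in *.
    assert (0 <= x) by (apply qbinom_ge_0; lra).
    assert (A : q ^ S (N + m) <= q ^ (2 * N - (N + m))).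
    { replace (S (N + m)) with (2 * N - (N + m) + (S (N + m) - (2 * N - (N + m))))%nat by lia.
      rewrite pow_add.
      pose proof (pow_le_1 q (2 * N - (N + m)) ltac:(lra)).
      pose proof (pow_le_1 q (S (N + m) - (2 * N - (N + m))) ltac:(lra)); nra. }
    assert (B : q ^ S (N + m) < 1).
    { simpl; pose proof (pow_le_1 q (N + m) ltac:(lra)); nra. }
    apply Rmult_le_reg_l with (1 - q ^ S (N + m)); [lra|].
    rewrite <- E; apply Rmult_le_compat_r; lra.
  - rewrite qbinom_small by lia; apply qbinom_ge_0; lra. }
split; [apply Rdiv_le_0_compat; lra|].
apply Rle_div_l; lra.
Qed.

Lemma qbinom_central_lim (q : R) (m : nat) : 0 <= q < 1 ->
  is_lim_seq (fun N => qbinom q (2 * N) (N + m) / qbinom q (2 * N) N) 1.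
Proof.
intros q01; induction m as [|m IH].
- apply is_lim_seq_ext with (fun _ => 1); [|apply is_lim_seq_const].
  intros N; rewrite Nat.add_0_r.
  pose proof (qbinom_ge_1 q (2 * N) N ltac:(lra) ltac:(lia)); field; lra.
- assert (geom : is_lim_seq (fun N => q ^ N) 0).
  { apply is_lim_seq_geom; rewrite Rabs_pos_eq; lra. }
  assert (l1 : is_lim_seq (fun N => 1 - q ^ (N - m)) (1 - 0)).
  { apply is_lim_seq_minus'; [apply is_lim_seq_const|].
    apply (is_lim_seq_incr_n _ m).
    apply is_lim_seq_ext with (2 := geom); intros N; f_equal; lia. }
  assert (l2 : is_lim_seq (fun N => 1 - q ^ S (N + m)) (1 - 0)).
  { apply is_lim_seq_minus'; [apply is_lim_seq_const|].
    apply (is_lim_seq_incr_1 (fun N => q ^ (N + m))).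
    apply (is_lim_seq_incr_n (fun N => q ^ N) m); exact geom. }
  pose proof (is_lim_seq_div' _ _ _ _ (is_lim_seq_mult' _ _ _ _ l1 IH) l2 ltac:(lra)) as L.
  replace ((1 - 0) * 1 / (1 - 0)) with 1 in L by field.
  apply is_lim_seq_ext_loc with (2 := L); exists m; intros N mN.
  pose proof (qbinom_ratio q (2 * N) (N + m) ltac:(lia)) as E.
  replace (2 * N - (N + m))%nat with (N - m)%nat in E by lia.
  rewrite Nat.add_succ_r; unfold Rdiv; rewrite <- Rmult_assoc, E.
  assert (B : q ^ S (N + m) < 1).
  { simpl; pose proof (pow_le_1 q (N + m) ltac:(lra)); nra. }
  pose proof (qbinom_ge_1 q (2 * N) N ltac:(lra) ltac:(lia)); field; lra.
Qed.

(** Tannery's theorem: each normalised coefficient tends to [Q^(m^2)], and the terms are dominated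
    by [C^m Q^(m^2)]. *)
Lemma gauss_row_series_lim (w : nat -> R) (C Q : R) : 0 < Q < 1 ->
  (forall m, Rabs (w m) <= C ^ m) ->
  is_lim_seq (fun N => sum_n (fun m => w m * gauss_row Q N m) N
    / qbinom (Q ^ 2) (2 * N) N) (gauss_series w Q).
Proof.
intros Q01 wC; assert (q01 : 0 <= Q ^ 2 < 1) by (simpl; nra).
set (a := fun N m => w m * Q ^ (m * m) *
  (qbinom (Q ^ 2) (2 * N) (N + m) / qbinom (Q ^ 2) (2 * N) N)).
apply is_lim_seq_ext with (fun N => Series (a N)).
- intros N.
  pose proof (qbinom_ge_1 (Q ^ 2) (2 * N) N ltac:(lra) ltac:(lia)) as c1.
  rewrite (Series_ext _ (fun m => w m * gauss_row Q N m * / qbinom (Q ^ 2) (2 * N) N)).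
  2:{ intros m; unfold a, gauss_row; field; lra. }
  rewrite Series_scal_r; unfold Rdiv; f_equal.
  (* Rows vanish beyond [m = N], so the full series equals the finite sum. *)
  rewrite (Series_incr_n _ (S N)), <- sum_n_Reals; simpl pred.
  + rewrite (Series_ext _ (fun _ => 0 * 0)).
    * rewrite Series_scal_l; ring_R.
    * intros k; rewrite gauss_row_small by lia; ring.
  + lia.
  + apply (ex_series_incr_n _ (S N)),
      ex_series_ext with (fun k => scal 0 (0 ^ k * Q ^ (k * k))).
    * intros k; rewrite gauss_row_small by lia.
      unfold scal; simpl; unfold mult; simpl; ring.
    * now apply (ex_series_scal (V := R_NormedModule) 0), ex_series_gauss.
- apply (dominated_series eventually) with (d := fun m => C ^ m * Q ^ (m * m)).
  + now apply ex_series_gauss.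
  + intros m; rewrite Rabs_mult, (Rabs_pos_eq (Q ^ _)) by (apply pow_le; lra).
    apply Rmult_le_compat_r; [apply pow_le; lra|easy].
  + intros m; unfold a.
    pose proof (is_lim_seq_mult' _ _ _ _ (is_lim_seq_const (w m * Q ^ (m * m)))
      (qbinom_central_lim (Q ^ 2) m q01)) as L.
    rewrite Rmult_1_r in L; exact L.
  + exists 0%nat; intros N _ m; unfold a.
    pose proof (qbinom_central_ratio (Q ^ 2) N m q01) as [r0 r1].
    rewrite !Rabs_mult, (Rabs_pos_eq (_ / _)), (Rabs_pos_eq (Q ^ _)) by (trivial; apply pow_le; lra).
    rewrite <- (Rmult_1_r (C ^ m * _)).
    apply Rmult_le_compat; trivial.
    * apply Rmult_le_pos; [apply Rabs_pos|apply pow_le; lra].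
    * apply Rmult_le_compat_r; [apply pow_le; lra|easy].
Qed.

(** The transfer principle: an inequality checked on rows of Pascal's triangle holds on the cone,
    hence for [gauss_row Q N], hence in the limit. *)
Lemma gauss_series_ge_0 (w : nat -> R) (C Q : R) : 0 < Q < 1 ->
  (forall m, Rabs (w m) <= C ^ m) ->
  (forall k M, (k <= M)%nat -> 0 <= sum_n (fun m => w m * gauss_row 1 k m) M) ->
  0 <= gauss_series w Q.
Proof.
intros Q01 wC H.
apply (is_lim_seq_le (fun _ => 0) _ 0 (gauss_series w Q)) with
  (2 := is_lim_seq_const 0) (3 := gauss_row_series_lim w C Q Q01 wC).
intros N; apply Rdiv_le_0_compat.
- apply row_cone_sum_ge_0; [apply row_cone_gauss_row; lra|now intros k; apply H].
- pose proof (qbinom_ge_1 (Q ^ 2) (2 * N) N (pow2_ge_0 Q) ltac:(lia)); lra.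
Qed.

(** * Monotonicity and lower bound of the partial theta series *)

Definition ptheta (Q r : R) : R := gauss_series (fun m => (- r) ^ m) Q.

Lemma ex_ptheta (Q r : R) : 0 < Q < 1 ->
  ex_series (fun m => (- r) ^ m * Q ^ (m * m)).
Proof. apply ex_series_gauss. Qed.

Lemma ptheta_shift (Q r : R) : 0 < Q < 1 ->
  ptheta Q r = 1 - Q * r * ptheta Q (Q ^ 2 * r).
Proof.
intros Q01; unfold ptheta, gauss_series.
rewrite Series_incr_1 by now apply ex_ptheta.
rewrite (Series_ext (fun k => (- r) ^ S k * Q ^ (S k * S k)) (fun k => - (Q * r) * ((- (Q ^ 2 * r)) ^ k * Q ^ (k * k)))).
- rewrite Series_scal_l; simpl; ring.
- intros k; replace (S k * S k)%nat with (S (2 * k + k * k)) by lia.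
  replace (- (Q ^ 2 * r)) with (Q ^ 2 * - r) by ring.
  rewrite Rpow_mult_distr, <- pow_mult.
  simpl pow; rewrite pow_add; simpl; ring.
Qed.

Lemma ptheta_decr_r (Q r1 r2 : R) : 0 < Q < 1 -> 0 <= r1 <= r2 -> r2 <= 1 ->
  ptheta Q r2 <= ptheta Q r1.
Proof.
intros Q01 r12 r21; apply Rminus_le_0; unfold ptheta, gauss_series.
rewrite <- Series_minus by now apply ex_ptheta.
rewrite (Series_ext _ (fun m => ((- r1) ^ m - (- r2) ^ m) * Q ^ (m * m)))
  by (intros m; ring).
(* Base [4] dominates: the weight is [0] at [m = 0] and at most [2] in absolute value afterwards. *)
apply (gauss_series_ge_0 _ 4); trivial.
- intros [|m]; [simpl; rewrite Rminus_diag_eq, Rabs_R0; lra|].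
  apply Rle_trans with 2.
  + replace 2 with (1 + 1) by ring; unfold Rminus.
    eapply Rle_trans; [apply Rabs_triang|].
    rewrite Rabs_Ropp, <- !RPow_abs, !Rabs_Ropp, !Rabs_pos_eq by lra.
    apply Rplus_le_compat; apply pow_le_1; lra.
  + assert (1 <= 4 ^ m) by (apply pow_R1_Rle; lra); simpl; lra.
- intros k M kM; apply row_alt_sum_decr; easy.
Qed.

Lemma ptheta_ge_half (Q r : R) : 0 < Q < 1 -> 0 <= r <= 1 -> 1 / 2 <= ptheta Q r.
Proof.
intros Q01 r01.
(* With these weights the series is [2 * ptheta Q r - 1]. *)
set (w := fun m => match m with O => 1 | S _ => 2 * (- r) ^ m end).
assert (H : 0 <= gauss_series w Q).
{ apply (gauss_series_ge_0 _ 4); trivial.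
  - intros [|m]; simpl; [rewrite Rabs_R1; lra|].
    rewrite !Rabs_mult, Rabs_Ropp, <- RPow_abs, Rabs_Ropp, !Rabs_pos_eq by lra.
    pose proof (pow_le_1 r m r01).
    assert (1 <= 4 ^ m) by (apply pow_R1_Rle; lra); nra.
  - intros k M kM.
    pose proof (row_alt_sum_ge_half r k M r01 kM) as A.
    assert (E : sum_n (fun m => w m * gauss_row 1 k m) M =
      2 * sum_n (fun m => (- r) ^ m * gauss_row 1 k m) M - gauss_row 1 k 0).
    { clear; induction M as [|M IH]; [rewrite !sum_n_0; simpl; ring_R|].
      rewrite !sum_n_S, IH; simpl; ring_R. }
    rewrite E; lra. }
unfold gauss_series in H; rewrite Series_incr_1 in H.
- unfold ptheta, gauss_series; rewrite Series_incr_1 by now apply ex_ptheta.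
  rewrite (Series_ext _ (fun k => 2 * ((- r) ^ S k * Q ^ (S k * S k)))) in H
    by (intros k; unfold w; ring).
  rewrite Series_scal_l in H; simpl in *; lra.
- apply ex_series_incr_1.
  apply ex_series_ext with (fun k => scal 2 ((- r) ^ S k * Q ^ (S k * S k))).
  + intros k; unfold w, scal; simpl; unfold mult; simpl; ring.
  + apply (ex_series_scal (V := R_NormedModule) 2), (ex_series_incr_1 (fun k => (- r) ^ k * Q ^ (k * k))).
    now apply ex_ptheta.
Qed.

Lemma INR_sqr_le_pow_4 (m : nat) : INR m ^ 2 <= 4 ^ m.
Proof.
assert (H : INR m <= 2 ^ m).
{ induction m as [|m IH]; [simpl; lra|].
  rewrite S_INR; simpl pow.
  assert (1 <= 2 ^ m) by (apply pow_R1_Rle; lra); lra. }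
replace 4 with (2 ^ 2) by (simpl; ring); rewrite <- pow_mult, Nat.mul_comm, pow_mult.
apply pow_incr; split; [apply pos_INR|easy].
Qed.

(* Up to the factor [1 / Q], the derivative in [Q] is the sum with weights
   [m^2 (- r)^m], which is nonpositive; the partial sums are compared instead, with an
   error bounded by the tail of [d]. *)
Lemma ptheta_decr_Q (Q1 Q2 r : R) : 0 < Q1 <= Q2 -> Q2 < 1 -> 0 <= r <= 1 ->
  ptheta Q2 r <= ptheta Q1 r.
Proof.
intros Q12 Q21 r01.
set (d := fun m => 4 ^ m * Q2 ^ (m * m)).
assert (dcv : ex_series d) by (apply ex_series_gauss; lra).
set (S_ := fun M Q => sum_n (fun m => (- r) ^ m * Q ^ (m * m)) M).
set (D_ := fun M Q => sum_n (fun m => INR m ^ 2 * (- r) ^ m * Q ^ (m * m)) M).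
assert (wb : forall m, Rabs (INR m ^ 2 * (- r) ^ m) <= 4 ^ m).
{ intros m; rewrite Rabs_mult, <- (RPow_abs (- r)), Rabs_Ropp, !Rabs_pos_eq
    by (try apply pow2_ge_0; lra).
  pose proof (pow_le_1 r m r01); pose proof (INR_sqr_le_pow_4 m).
  pose proof (pow2_ge_0 (INR m)); nra. }
assert (Dle : forall M Q, Q1 <= Q <= Q2 -> D_ M Q <= Series d - sum_n d M).
{ intros M Q HQ.
  assert (neg : gauss_series (fun m => INR m ^ 2 * (- r) ^ m) Q <= 0).
  { enough (0 <= gauss_series (fun m => (- 1) * (INR m ^ 2 * (- r) ^ m)) Q) as E.
    - unfold gauss_series in *.
      rewrite (Series_ext _ (fun m => (- 1) * (INR m ^ 2 * (- r) ^ m * Q ^ (m * m)))) in E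
        by (intros m; ring).
      rewrite Series_scal_l in E; lra.
    - apply (gauss_series_ge_0 _ 4); [lra| |].
      + intros m; rewrite Rabs_mult, (Rabs_left (- 1)) by lra; specialize (wb m); lra.
      + intros k M' kM.
        rewrite (sum_n_ext _ (fun m => (- 1) * (INR m ^ 2 * (- r) ^ m * gauss_row 1 k m)
          + 0 * 0)) by (intros m; ring_R).
        rewrite sum_n_lin; pose proof (row_alt_sum_sqr_le_0 r k M' r01 kM); lra. }
  assert (T : Rabs (gauss_series (fun m => INR m ^ 2 * (- r) ^ m) Q - D_ M Q)
    <= Series d - sum_n d M).
  { apply Series_tail_le; trivial; intros m; unfold d.
    rewrite Rabs_mult, (Rabs_pos_eq (Q ^ _)) by (apply pow_le; lra).
    apply Rmult_le_compat; [apply Rabs_pos|apply pow_le; lra|apply wb|].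
    apply pow_incr; lra. }
  apply Rabs_le_between in T; lra. }
assert (der : forall M Q, 0 < Q -> is_derive (S_ M) Q (D_ M Q / Q)).
{ intros M Q Q0; unfold S_, D_; induction M as [|M IH].
  - apply is_derive_ext with (fun _ => 1); [intros t; rewrite sum_n_0; simpl; ring|].
    rewrite sum_n_0; auto_derive; trivial; simpl; field; lra.
  - apply is_derive_ext with (fun t => sum_n (fun m => (- r) ^ m * t ^ (m * m)) M +
      (- r) ^ S M * t ^ (S M * S M)); [intros t; now rewrite sum_n_S|].
    rewrite sum_n_S, Rdiv_plus_distr.
    apply (is_derive_plus (V := R_NormedModule)); [exact IH|].
    auto_derive; trivial.
    replace (pred (S M * S M)) with (M + M * S M)%nat by lia.
    change (match (M + M * S M)%nat with 0%nat => 1 | S _ => INR (M + M * S M) + 1 end)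
      with (INR (S M * S M)).
    replace (Q ^ (S M * S M)) with (Q * Q ^ (M + M * S M)) by easy.
    rewrite mult_INR; generalize (INR (S M)) (Q ^ (M + M * S M)); intros x y.
    simpl; field; lra. }
assert (incr : forall M, S_ M Q2 - S_ M Q1 <= (Series d - sum_n d M) * ((Q2 - Q1) / Q1)).
{ intros M.
  destruct (MVT_gen (S_ M) Q1 Q2 (fun Q => D_ M Q / Q)) as [xi [Hxi ->]].
  - intros Q; rewrite Rmin_left by lra; intros HQ; apply der; lra.
  - intros Q; rewrite Rmin_left by lra; intros HQ.
    apply derivable_continuous_pt; exists (D_ M Q / Q).
    apply is_derive_Reals, der; lra.
  - rewrite Rmin_left, Rmax_right in Hxi by lra.
    specialize (Dle M xi Hxi).
    assert (0 <= Series d - sum_n d M).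
    { eapply Rle_trans; [apply Rabs_pos|apply (Series_tail_le d d)]; trivial.
      intros m; rewrite Rabs_pos_eq; [lra|].
      apply Rmult_le_pos; apply pow_le; lra. }
    unfold Rdiv; rewrite (Rmult_comm (Q2 - Q1)), <- Rmult_assoc.
    apply Rmult_le_compat_r; [lra|].
    assert (0 < / xi <= / Q1) by (split; [apply Rinv_0_lt_compat|apply Rinv_le_contravar]; lra).
    nra. }
assert (lim : forall Q, 0 < Q < 1 -> is_lim_seq (fun M => S_ M Q) (ptheta Q r)).
{ intros Q HQ; apply (Series_correct _ (ex_ptheta Q r HQ)). }
apply Rminus_le.
(* This is the limit of the error bound in [incr] as [M] grows. *)
replace 0 with ((Series d - Series d) * ((Q2 - Q1) / Q1)) by (field; lra).
apply (is_lim_seq_le _ _ (ptheta Q2 r - ptheta Q1 r) ((Series d - Series d) * ((Q2 - Q1) / Q1)) incr).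
- apply is_lim_seq_minus'; apply lim; lra.
- apply is_lim_seq_mult'; [|apply is_lim_seq_const].
  apply is_lim_seq_minus'; [apply is_lim_seq_const|apply (Series_correct d dcv)].
Qed.

(** * The triple product *)

Fixpoint triple_prod (Q r : R) (N : nat) : R :=
  match N with
  | O => 1
  | S n => triple_prod Q r n * ((1 - Q ^ (2 * n + 1) * r) * (1 - Q ^ (2 * n + 1) * / r))
  end.

Lemma triple_prod_S (Q r : R) (n : nat) : triple_prod Q r (S n) =
  triple_prod Q r n * ((1 - Q ^ (2 * n + 1) * r) * (1 - Q ^ (2 * n + 1) * / r)).
Proof. reflexivity. Qed.

(** A half row stands for a symmetric Laurent polynomial in [s]; [p 0] is subtracted because
    [c 0 = 2] counts the centre twice. The last two terms come from the truncation at [M]. *)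
Lemma lap_sum (s : R) (p : nat -> R) (M : nat) : s <> 0 ->
  let c m := s ^ m + (/ s) ^ m in
  sum_n (fun m => c m * lap p m) M - lap p 0 =
  (s + / s + 2) * (sum_n (fun m => c m * p m) M - p 0%nat) +
  c M * p (S M) - c (S M) * p M.
Proof.
intros s0 c; induction M as [|M IH].
- rewrite !sum_n_0; unfold c, lap; simpl; ring_R.
- rewrite !sum_n_S.
  replace (sum_n (fun m => c m * lap p m) M) with
    ((s + / s + 2) * (sum_n (fun m => c m * p m) M - p 0%nat) +
     c M * p (S M) - c (S M) * p M + lap p 0) by (rewrite <- IH; ring_R).
  assert (E : c (S (S M)) = (s + / s) * c (S M) - c M).
  { unfold c; simpl; field; easy. }
  rewrite E; simpl lap; ring_R.
Qed.


(** The finite Jacobi triple product. With [s = - r], one step multiplies by [(1 - t)^2 + t (s + 1/s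
    + 2) = (1 - t r)(1 - t / r)]. *)
Lemma gauss_row_sum (Q r : R) (N M : nat) : r <> 0 -> (N <= M)%nat ->
  sum_n (fun m => ((- r) ^ m + (/ - r) ^ m) * gauss_row Q N m) M - gauss_row Q N 0 =
  triple_prod Q r N.
Proof.
intros r0; revert M; induction N as [|N IH]; intros M NM.
- assert (E : sum_n (fun m => ((- r) ^ m + (/ - r) ^ m) * gauss_row Q 0 m) M = 2).
  { clear; induction M as [|M IH].
    - rewrite sum_n_0; unfold gauss_row; simpl; ring_R.
    - rewrite sum_n_S, IH, gauss_row_small by lia; ring_R. }
  rewrite E; unfold gauss_row; simpl; ring_R.
- set (t := Q ^ (2 * N + 1)).
  pose proof (lap_sum (- r) (gauss_row Q N) M ltac:(lra)) as L; simpl in L.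
  rewrite (sum_n_ext _ (fun m => (1 - t) ^ 2 * (((- r) ^ m + (/ - r) ^ m) * gauss_row Q N m) +
    t * (((- r) ^ m + (/ - r) ^ m) * lap (gauss_row Q N) m))).
  2:{ intros m; rewrite gauss_row_S; fold t; ring_R. }
  rewrite sum_n_lin, gauss_row_S; fold t.
  change (2 * gauss_row Q N 0 + 2 * gauss_row Q N 1) with (lap (gauss_row Q N) 0) in L.
  rewrite (gauss_row_small Q N (S M)), (gauss_row_small Q N M) in L by lia.
  rewrite triple_prod_S; fold t; rewrite <- IH with (M := M) by lia.
  clear IH; revert L.
  generalize (sum_n (fun m => ((- r) ^ m + (/ - r) ^ m) * lap (gauss_row Q N) m) M).
  generalize (sum_n (fun m => ((- r) ^ m + (/ - r) ^ m) * gauss_row Q N m) M).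
  generalize (lap (gauss_row Q N) 0) (gauss_row Q N 0) t.
  simpl; intros z p0 x X Y L; apply Rminus_diag_uniq.
  replace Y with ((- r + / - r + 2) * (X - p0) + z) by lra; field; lra.
Qed.

Lemma triple_prod_lim (Q r : R) : 0 < Q < 1 -> 0 < r ->
  is_lim_seq (fun N => triple_prod Q r N / qbinom (Q ^ 2) (2 * N) N)
    (ptheta Q r + ptheta Q (/ r) - 1).
Proof.
intros Q01 r0.
assert (bound : forall s m, 0 < s -> Rabs ((- s) ^ m) <= s ^ m).
{ intros s m s0; rewrite <- RPow_abs, Rabs_Ropp, Rabs_pos_eq; lra. }
pose proof (gauss_row_series_lim _ r Q Q01 (fun m => bound r m r0)) as L1.
pose proof (gauss_row_series_lim _ (/ r) Q Q01
  (fun m => bound _ m (Rinv_0_lt_compat r r0))) as L2.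
pose proof (is_lim_seq_minus' _ _ _ _ (is_lim_seq_plus' _ _ _ _ L1 L2)
  (is_lim_seq_const 1)) as L.
apply is_lim_seq_ext with (2 := L); intros N.
rewrite <- (gauss_row_sum Q r N N) by (lia || lra).
pose proof (qbinom_ge_1 (Q ^ 2) (2 * N) N (pow2_ge_0 Q) ltac:(lia)).
rewrite (sum_n_ext (fun m => ((- r) ^ m + (/ - r) ^ m) * gauss_row Q N m)
  (fun m => 1 * ((- r) ^ m * gauss_row Q N m) + 1 * ((- / r) ^ m * gauss_row Q N m))).
- rewrite sum_n_lin; unfold gauss_row at 5; rewrite Nat.add_0_r; simpl (Q ^ (0 * 0)).
  field; lra.
- intros m; rewrite Rinv_opp; ring_R.
Qed.

(** The finite q-Pochhammer symbol, the product of [1 - mu q^i] over [i < n]. *)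
Fixpoint qpoch (mu q : R) (n : nat) : R :=
  match n with O => 1 | S n' => (1 - mu) * qpoch (mu * q) q n' end.

Lemma qpoch_S_r (mu q : R) (n : nat) :
  qpoch mu q (S n) = qpoch mu q n * (1 - mu * q ^ n).
Proof.
revert mu; induction n as [|n IH]; intros mu; [simpl; ring|].
change (qpoch mu q (S (S n))) with ((1 - mu) * qpoch (mu * q) q (S n)).
rewrite IH; simpl; ring.
Qed.

(** A Bernoulli-type bound gives at least [1/2] once [mu <= (1 - q) / 2]. Finitely many positive
    factors are split off to reach that case. *)
Lemma qpoch_lower_bound (mu q : R) : 0 <= mu < 1 -> 0 <= q < 1 ->
  exists delta, 0 < delta /\ forall n, delta <= qpoch mu q n.
Proof.
intros mu01 q01.
assert (bernoulli : forall n nu, 0 <= nu < 1 -> 1 - nu / (1 - q) <= qpoch nu q n).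
{ induction n as [|n IH]; intros nu nu01; simpl.
  - assert (0 <= nu / (1 - q)) by (apply Rdiv_le_0_compat; lra); lra.
  - specialize (IH (nu * q) ltac:(nra)).
    assert (E : nu / (1 - q) = nu + nu * q / (1 - q)) by (field; lra).
    assert (0 <= nu * q / (1 - q)) by (apply Rdiv_le_0_compat; nra).
    rewrite E; nra. }
assert (small : exists K, mu * q ^ K <= (1 - q) / 2).
{ destruct (pow_lt_1_zero q ltac:(rewrite Rabs_pos_eq; lra) ((1 - q) / 2) ltac:(lra))
    as [K HK].
  exists K; specialize (HK K (Nat.le_refl K)).
  rewrite Rabs_pos_eq in HK by (apply pow_le; lra).
  pose proof (pow_le q K ltac:(lra)); nra. }
destruct small as [K HK]; revert mu mu01 HK.
induction K as [|K IH]; intros mu mu01 HK.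
- exists (1 / 2); split; [lra|]; intros n.
  eapply Rle_trans; [|now apply bernoulli].
  simpl in HK; assert (mu / (1 - q) <= 1 / 2); [|lra].
  apply Rle_div_l; lra.
- destruct (IH (mu * q) ltac:(nra)) as [delta [d0 Hd]]; [simpl in HK; lra|].
  (* The minimum with [1] covers the empty product. *)
  exists ((1 - mu) * Rmin delta 1); split.
  + apply Rmult_lt_0_compat; [lra|apply Rmin_glb_lt; lra].
  + intros [|n]; simpl.
    * pose proof (Rmin_r delta 1); pose proof (Rmin_glb_lt delta 1 0); nra.
    * apply Rmult_le_compat_l; [lra|].
      eapply Rle_trans; [apply Rmin_l|apply Hd].
Qed.

(** By the ratio relation the left side is the product of [1 - q^(n - i)] over [i < k]. *)
Lemma qbinom_qpoch_le_1 (q : R) (n k : nat) : 0 <= q < 1 -> (k <= n)%nat ->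
  qpoch q q k * qbinom q n k <= 1.
Proof.
intros q01; induction k as [|k IH]; intros H; [simpl; rewrite qbinom_0; lra|].
rewrite qpoch_S_r, Rmult_assoc; change (q * q ^ k) with (q ^ S k).
rewrite <- qbinom_ratio by lia.
assert (0 <= qpoch q q k).
{ clear -q01; induction k as [|k IH]; [simpl; lra|].
  rewrite qpoch_S_r; pose proof (pow_le_1 q (S k) ltac:(lra)); simpl in *.
  apply Rmult_le_pos; lra. }
specialize (IH ltac:(lia)); pose proof (qbinom_ge_0 q n k ltac:(lra)).
pose proof (pow_le_1 q (n - k) ltac:(lra)).
assert (0 <= qpoch q q k * qbinom q n k) by now apply Rmult_le_pos.
nra.
Qed.

(** * Passage to real exponents of [q] *)

Definition psi (q a : R) : R := ptheta (sqrt q) (Rpower q (1 / 2 - a)).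

Definition full_theta (q a : R) : R := psi q a + psi q (1 - a) - 1.

Lemma sqrt_in_01 (q : R) : 0 < q < 1 -> 0 < sqrt q < 1.
Proof.
intros H; split; [apply sqrt_lt_R0; lra|].
rewrite <- sqrt_1; apply sqrt_lt_1; lra.
Qed.

Lemma sqrt_pow_Rpower (q : R) (n : nat) : 0 < q -> sqrt q ^ n = Rpower q (INR n / 2).
Proof.
intros q0; rewrite <- Rpower_pow by now apply sqrt_lt_R0.
rewrite <- Rpower_sqrt, Rpower_mult by easy; f_equal; field.
Qed.

Lemma Rpower_pos (q e : R) : 0 < Rpower q e.
Proof. apply exp_pos. Qed.

Lemma Rpower_le_1 (q e : R) : 0 < q <= 1 -> 0 <= e -> Rpower q e <= 1.
Proof.
intros q01 e0; destruct (Rle_lt_or_eq_dec 0 e e0) as [e0'|<-].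
- replace 1 with (Rpower 1 e); [apply Rle_Rpower_l; lra|].
  unfold Rpower; rewrite ln_1, Rmult_0_r; apply exp_0.
- rewrite Rpower_O; lra.
Qed.

Lemma Rpower_lt_1 (q e : R) : 0 < q < 1 -> 0 < e -> Rpower q e < 1.
Proof.
intros q01 e0; replace 1 with (Rpower 1 e); [apply Rlt_Rpower_l; lra|].
unfold Rpower; rewrite ln_1, Rmult_0_r; apply exp_0.
Qed.

Lemma theta_psi (q a : R) : 0 < q -> theta q (- Rpower q (- a)) = psi q a.
Proof.
intros q0; unfold theta, psi, ptheta, gauss_series, PSeries.
apply Series_ext; intros m; unfold theta_coef.
replace (- Rpower q (1 / 2 - a)) with (sqrt q * - Rpower q (- a)).
2:{ rewrite <- Rpower_sqrt by easy; unfold Rminus; rewrite Rpower_plus.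
    replace (1 / 2) with (/ 2) by field; ring. }
rewrite Rpow_mult_distr.
replace q with (sqrt q ^ 2) at 1 by (simpl; rewrite Rmult_1_r; apply sqrt_sqrt; lra).
rewrite <- pow_mult, triangular_double, pow_add; ring.
Qed.

Lemma psi_shift (q a : R) : 0 < q < 1 ->
  psi q a = 1 - Rpower q (1 - a) * psi q (a - 1).
Proof.
intros q01; unfold psi; rewrite ptheta_shift by now apply sqrt_in_01.
do 2 f_equal.
- rewrite <- Rpower_sqrt, <- Rpower_plus by lra; f_equal; field.
- f_equal; simpl; rewrite Rmult_1_r, sqrt_sqrt by lra.
  rewrite <- (Rpower_1 q) at 1 by lra; rewrite <- Rpower_plus; f_equal; field.
Qed.

Lemma full_theta_shift (q a : R) : 0 < q < 1 ->
  full_theta q (a + 1) = - Rpower q (- a) * full_theta q a.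
Proof.
intros q01; unfold full_theta.
rewrite (psi_shift q (a + 1)), (psi_shift q (1 - a)) by easy.
replace (1 - (a + 1)) with (- a) by ring; replace (a + 1 - 1) with a by ring.
replace (1 - (1 - a)) with a by ring; replace (1 - a - 1) with (- a) by ring.
rewrite Rpower_Ropp; field; apply Rgt_not_eq, Rpower_pos.
Qed.

Lemma full_theta_shift_n (q b : R) (n : nat) : 0 < q < 1 ->
  full_theta q (b + INR n) =
  (-1) ^ n * Rpower q (- (INR n * b + INR n * (INR n - 1) / 2)) * full_theta q b.
Proof.
intros q01; induction n as [|n IH].
- replace (- _) with 0 by (simpl; field); rewrite Rpower_O by lra.
  simpl; rewrite Rplus_0_r; ring.
- rewrite S_INR, <- Rplus_assoc, full_theta_shift, IH by easy.
  replace (- ((INR n + 1) * b + (INR n + 1) * (INR n + 1 - 1) / 2)) with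
    (- (b + INR n) + - (INR n * b + INR n * (INR n - 1) / 2)) by field.
  rewrite Rpower_plus; simpl; ring.
Qed.

Lemma triple_prod_factor (q a : R) (n : nat) : 0 < q ->
  sqrt q ^ (2 * n + 1) * Rpower q (1 / 2 - a) = Rpower q (INR n + 1 - a).
Proof.
intros q0; rewrite sqrt_pow_Rpower, <- Rpower_plus by easy; f_equal.
rewrite plus_INR, mult_INR; simpl; field.
Qed.

Definition theta_prod (q b : R) (N : nat) : R :=
  triple_prod (sqrt q) (Rpower q (1 / 2 - b)) N.

Lemma theta_prod_S (q b : R) (n : nat) : 0 < q -> theta_prod q b (S n) =
  theta_prod q b n * ((1 - Rpower q (INR n + 1 - b)) * (1 - Rpower q (INR n + b))).
Proof.
intros q0; unfold theta_prod; rewrite triple_prod_S.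
rewrite <- Rpower_Ropp.
replace (- (1 / 2 - b)) with (1 / 2 - (1 - b)) by field.
rewrite !triple_prod_factor by easy.
now replace (INR n + 1 - (1 - b)) with (INR n + b) by ring.
Qed.

Lemma theta_prod_lim (q b : R) : 0 < q < 1 ->
  is_lim_seq (fun N => theta_prod q b N / qbinom q (2 * N) N) (full_theta q b).
Proof.
intros q01.
pose proof (triple_prod_lim (sqrt q) (Rpower q (1 / 2 - b)) (sqrt_in_01 q q01)
  (Rpower_pos _ _)) as L.
rewrite <- Rpower_Ropp in L.
replace (- (1 / 2 - b)) with (1 / 2 - (1 - b)) in L by field.
replace (sqrt q ^ 2) with q in L; [exact L|].
simpl; rewrite Rmult_1_r, sqrt_sqrt; lra.
Qed.

Lemma theta_factor_bounds (q b : R) (n : nat) : 0 < q < 1 -> 0 <= b <= 1 ->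
  0 <= 1 - Rpower q (INR n + 1 - b) <= 1 /\ 0 <= 1 - Rpower q (INR n + b) <= 1.
Proof.
intros q01 b01; pose proof (pos_INR n).
pose proof (Rpower_le_1 q (INR n + 1 - b) ltac:(lra) ltac:(lra)).
pose proof (Rpower_le_1 q (INR n + b) ltac:(lra) ltac:(lra)).
pose proof (Rpower_pos q (INR n + 1 - b)); pose proof (Rpower_pos q (INR n + b)); lra.
Qed.

Lemma theta_prod_ge_0 (q b : R) (N : nat) : 0 < q < 1 -> 0 <= b <= 1 ->
  0 <= theta_prod q b N.
Proof.
intros q01 b01; induction N as [|n IH]; [unfold theta_prod; simpl; lra|].
rewrite theta_prod_S by lra.
pose proof (theta_factor_bounds q b n q01 b01).
apply Rmult_le_pos; [easy|apply Rmult_le_pos; lra].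
Qed.

Lemma full_theta_ge_0 (q b : R) : 0 < q < 1 -> 0 <= b <= 1 -> 0 <= full_theta q b.
Proof.
intros q01 b01.
apply (is_lim_seq_le (fun _ => 0) _ 0 (full_theta q b)) with
  (2 := is_lim_seq_const 0) (3 := theta_prod_lim q b q01).
intros N; apply Rdiv_le_0_compat; [now apply theta_prod_ge_0|].
pose proof (qbinom_ge_1 q (2 * N) N ltac:(lra) ltac:(lia)); lra.
Qed.

(** Only the first pair of factors is kept: later factors are at most [1] and the denominators at
    least [1]. The bound forces [full_theta q b] to [0] as [q] tends to [1] when [0 < b < 1]. *)
Lemma full_theta_le (q b : R) : 0 < q < 1 -> 0 <= b <= 1 ->
  full_theta q b <= (1 - Rpower q b) * (1 - Rpower q (1 - b)).
Proof.
intros q01 b01.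
set (B := (1 - Rpower q b) * (1 - Rpower q (1 - b))).
apply (is_lim_seq_le_loc _ (fun _ => B) (full_theta q b) B) with
  (2 := theta_prod_lim q b q01) (3 := is_lim_seq_const B).
exists 1%nat; intros N N1.
assert (H : theta_prod q b N <= B).
{ destruct N as [|N]; [lia|]; clear N1; induction N as [|N IH].
  - rewrite theta_prod_S by lra; unfold theta_prod, B; simpl.
    rewrite !Rplus_0_l; lra.
  - rewrite theta_prod_S by lra.
    pose proof (theta_factor_bounds q b (S N) q01 b01) as [f1 f2].
    pose proof (theta_prod_ge_0 q b (S N) q01 b01).
    set (x := 1 - _) in f1 |- *; set (y := 1 - Rpower q (INR (S N) + b)) in *.
    assert (0 <= x * y <= 1) by nra; nra. }
pose proof (qbinom_ge_1 q (2 * N) N ltac:(lra) ltac:(lia)).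
pose proof (theta_prod_ge_0 q b N q01 b01).
apply Rle_div_l; [lra|]; nra.
Qed.

(** Every factor of the product is nonnegative and nonincreasing in [q], while the central
    coefficient below it is nondecreasing. *)
Lemma full_theta_decr (q1 q2 b : R) : 0 < q1 <= q2 -> q2 < 1 -> 0 <= b <= 1 ->
  full_theta q2 b <= full_theta q1 b.
Proof.
intros q12 q21 b01.
apply (is_lim_seq_le (fun N => theta_prod q2 b N / qbinom q2 (2 * N) N)
  (fun N => theta_prod q1 b N / qbinom q1 (2 * N) N) (full_theta q2 b) (full_theta q1 b));
  [|apply theta_prod_lim; lra..].
intros N.
assert (H : theta_prod q2 b N <= theta_prod q1 b N).
{ induction N as [|n IH]; [unfold theta_prod; simpl; lra|].
  rewrite !theta_prod_S by lra.
  pose proof (theta_factor_bounds q2 b n ltac:(lra) b01).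
  pose proof (theta_prod_ge_0 q2 b n ltac:(lra) b01).
  pose proof (pos_INR n).
  assert (Rpower q1 (INR n + 1 - b) <= Rpower q2 (INR n + 1 - b))
    by (apply Rle_Rpower_l; lra).
  assert (Rpower q1 (INR n + b) <= Rpower q2 (INR n + b))
    by (apply Rle_Rpower_l; lra).
  apply Rmult_le_compat; [easy|apply Rmult_le_pos; lra|easy|].
  apply Rmult_le_compat; lra. }
pose proof (qbinom_ge_1 q1 (2 * N) N ltac:(lra) ltac:(lia)).
pose proof (qbinom_le q1 q2 (2 * N) N ltac:(lra)).
apply Rmult_le_compat; trivial.
- apply theta_prod_ge_0; lra.
- apply Rlt_le, Rinv_0_lt_compat; lra.
- apply Rinv_le_contravar; lra.
Qed.

(** Positive terms alone could tend to zero, so numerator and denominator are bounded uniformly in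
    [N] by q-Pochhammer symbols. *)
Lemma full_theta_pos (q b : R) : 0 < q < 1 -> 0 < b < 1 -> 0 < full_theta q b.
Proof.
intros q01 b01.
set (mu := Rmax (Rpower q b) (Rpower q (1 - b))).
assert (mu01 : 0 <= mu < 1).
{ split.
  - eapply Rle_trans; [apply Rlt_le, Rpower_pos|apply Rmax_l].
  - apply Rmax_lub_lt; apply Rpower_lt_1; lra. }
destruct (qpoch_lower_bound mu q mu01 ltac:(lra)) as [d1 [d1p Hd1]].
destruct (qpoch_lower_bound q q ltac:(lra) ltac:(lra)) as [d2 [d2p Hd2]].
assert (low : forall N, qpoch mu q N ^ 2 <= theta_prod q b N).
{ induction N as [|n IH]; [unfold theta_prod; simpl; lra|].
  rewrite theta_prod_S, qpoch_S_r by lra.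
  assert (f1 : Rpower q (INR n + 1 - b) <= mu * q ^ n).
  { replace (INR n + 1 - b) with (1 - b + INR n) by ring.
    rewrite Rpower_plus, Rpower_pow by lra.
    apply Rmult_le_compat_r; [apply pow_le; lra|apply Rmax_r]. }
  assert (f2 : Rpower q (INR n + b) <= mu * q ^ n).
  { rewrite Rplus_comm, Rpower_plus, Rpower_pow by lra.
    apply Rmult_le_compat_r; [apply pow_le; lra|apply Rmax_l]. }
  pose proof (pow_le_1 q n ltac:(lra)).
  assert (0 <= 1 - mu * q ^ n) by nra.
  rewrite Rpow_mult_distr; apply Rmult_le_compat; trivial; try apply pow2_ge_0.
  simpl; rewrite Rmult_1_r; apply Rmult_le_compat; lra. }
apply Rlt_le_trans with (d1 ^ 2 * d2).
{ apply Rmult_lt_0_compat; [apply pow_lt|]; lra. }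
apply (is_lim_seq_le (fun _ => d1 ^ 2 * d2) _ (d1 ^ 2 * d2) (full_theta q b)) with
  (2 := is_lim_seq_const _) (3 := theta_prod_lim q b q01).
intros N; pose proof (qbinom_ge_1 q (2 * N) N ltac:(lra) ltac:(lia)).
pose proof (qbinom_qpoch_le_1 q (2 * N) N ltac:(lra) ltac:(lia)).
specialize (low N); specialize (Hd1 N); specialize (Hd2 N).
assert (d1 ^ 2 <= qpoch mu q N ^ 2) by (apply pow_incr; lra).
apply (proj1 (Rle_div_r (d1 ^ 2 * d2) (theta_prod q b N) (qbinom q (2 * N) N) ltac:(lra))).
set (c := qbinom q (2 * N) N) in *; set (p := qpoch q q N) in *.
assert (d2 * c <= 1) by nra.
assert (0 <= d1 ^ 2) by apply pow2_ge_0.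
rewrite Rmult_assoc; nra.
Qed.

(** For [a >= 1/2] the argument [q^(a - 1/2)] is at most [1]. The upper bound combines
    [psi q (1 - a) = 1 - q^a psi q (- a)] with [psi q (1 - a) <= psi q (- a)]. *)
Lemma psi_neg_bounds (q a : R) : 0 < q < 1 -> 1 / 2 <= a ->
  1 / 2 <= psi q (1 - a) <= / (1 + Rpower q a).
Proof.
intros q01 a2; split.
- apply ptheta_ge_half; [now apply sqrt_in_01|].
  split; [apply Rlt_le, Rpower_pos|apply Rpower_le_1; lra].
- assert (H : psi q (1 - a) <= psi q (1 - a - 1)).
  { apply ptheta_decr_r; [now apply sqrt_in_01| |apply Rpower_le_1; lra].
    split; [apply Rlt_le, Rpower_pos|].
    replace (1 / 2 - (1 - a - 1)) with (1 / 2 - (1 - a) + 1) by ring.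
    rewrite Rpower_plus, Rpower_1 by lra.
    pose proof (Rpower_pos q (1 / 2 - (1 - a))); nra. }
  pose proof (psi_shift q (1 - a) q01) as E.
  replace (1 - (1 - a)) with a in E by ring.
  pose proof (Rpower_pos q a).
  rewrite <- (Rmult_1_l (/ _)); apply (proj1 (Rle_div_r (psi q (1 - a)) 1 (1 + Rpower q a) ltac:(lra))); nra.
Qed.

Lemma psi_neg_decr (q1 q2 a : R) : 0 < q1 <= q2 -> q2 < 1 -> 1 / 2 <= a ->
  psi q2 (1 - a) <= psi q1 (1 - a).
Proof.
intros q12 q21 a2; unfold psi.
assert (e : 0 <= 1 / 2 - (1 - a)) by lra.
pose proof (Rpower_pos q1 (1 / 2 - (1 - a))).
pose proof (Rpower_le_1 q2 _ ltac:(lra) e).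
assert (Rpower q1 (1 / 2 - (1 - a)) <= Rpower q2 (1 / 2 - (1 - a)))
  by (apply Rle_Rpower_l; lra).
pose proof (sqrt_in_01 q1 ltac:(lra)); pose proof (sqrt_in_01 q2 ltac:(lra)).
apply Rle_trans with (ptheta (sqrt q2) (Rpower q1 (1 / 2 - (1 - a)))).
- apply ptheta_decr_r; lra.
- apply ptheta_decr_Q; [|lra|lra].
  split; [lra|apply sqrt_le_1; lra].
Qed.

Lemma psi_continuous (q a : R) : 0 < q < 1 ->
  filterlim (fun q => psi q a) (locally q) (locally (psi q a)).
Proof.
intros q01; set (r := fun t => Rpower t (1 / 2 - a)).
assert (rc : continuous r q).
{ apply (ex_derive_continuous (V := R_NormedModule)); unfold r, Rpower; auto_derive; lra. }
(* A dominating series valid for all [t] near [q]: there [r t < r q + 1] and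
   [t < (1 + q) / 2 < 1]. *)
set (d := fun m => (r q + 1) ^ m * sqrt ((1 + q) / 2) ^ (m * m)).
assert (near : locally q (fun t => forall m, Rabs ((- r t) ^ m * sqrt t ^ (m * m)) <= d m)).
{ assert (n1 : locally q (fun t => r t < r q + 1)).
  { apply (rc (fun y => y < r q + 1)), (open_lt (r q + 1)); lra. }
  assert (n2 : locally q (fun t => t < (1 + q) / 2)) by (apply (open_lt _ q); lra).
  generalize (filter_and _ _ n1 n2); apply filter_imp; intros t [t1 t2] m.
  assert (0 < r t) by apply Rpower_pos.
  rewrite Rabs_mult, <- RPow_abs, Rabs_Ropp, !Rabs_pos_eq by
    (try apply pow_le, sqrt_pos; lra).
  apply Rmult_le_compat; try apply pow_le; try apply sqrt_pos; try lra.
  - apply pow_incr; lra.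
  - apply pow_incr; split; [apply sqrt_pos|].
    apply sqrt_le_1_alt; lra. }
apply (dominated_series (locally q)) with (d := d); trivial.
- apply ex_series_gauss, sqrt_in_01; lra.
- apply (locally_singleton _ _ near).
- intros m; apply (ex_derive_continuous (V := R_NormedModule)
    (fun t => (- r t) ^ m * sqrt t ^ (m * m))).
  unfold r, Rpower; auto_derive; repeat split; lra.
Qed.

(** * Splitting the partial theta function *)

Lemma psi_split (q b : R) (n : nat) : 0 < q < 1 ->
  psi q (b + INR n) =
  (-1) ^ n * Rpower q (- (INR n * b + INR n * (INR n - 1) / 2)) * full_theta q b
  + (1 - psi q (1 - (b + INR n))).
Proof.
intros q01; rewrite <- full_theta_shift_n by easy; unfold full_theta; ring.
Qed.

(** On [(2j - 1, 2j)] the integer part [n = 2j - 1] is odd, which gives the minus sign, and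
    [b = a - n] lies strictly between [0] and [1]. *)
Lemma psi_split_Kdagger (a : R) : Kdagger a -> 1 < a /\
  exists b c, 0 < b < 1 /\ 0 < c /\ forall q, 0 < q < 1 ->
    psi q a = - Rpower q (- c) * full_theta q b + (1 - psi q (1 - a)).
Proof.
intros [j [j1 Hj]]; destruct j as [|j]; [lia|]; rewrite S_INR in Hj.
pose proof (pos_INR j); split; [lra|].
set (n := S (2 * j)).
assert (En : INR n = 2 * INR j + 1) by (unfold n; rewrite S_INR, mult_INR; simpl; ring).
exists (a - INR n), (INR n * (a - INR n) + INR n * (INR n - 1) / 2).
split; [lra|split].
- apply Rplus_lt_le_0_compat; [apply Rmult_lt_0_compat; lra|].
  apply Rmult_le_pos; [apply Rmult_le_pos; lra|lra].
- intros q q01; pose proof (psi_split q (a - INR n) n q01) as E.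
  replace (a - INR n + INR n) with a in E by ring.
  rewrite E; unfold n; rewrite pow_1_odd; ring.
Qed.

(** Here [n] is even, so the first summand is nonnegative, and the second is
    [q^a psi q (- a) >= q^a / 2 > 0]. *)
Lemma psi_ne_0 (q a : R) : 0 < q < 1 -> 0 < a -> ~ Kdagger a -> psi q a <> 0.
Proof.
intros q01 a0 nK.
assert (dec : exists (j : nat) (b : R), 0 <= b <= 1 /\ a = b + INR (2 * j)).
{ destruct (nfloor_ex a ltac:(lra)) as [n Hn].
  destruct (Nat.Even_or_Odd n) as [[j ->]|[j ->]].
  - exists j, (a - INR (2 * j)); split; [lra|ring].
  - rewrite plus_INR in Hn; change (INR 1) with 1 in Hn.
    (* An odd integer [2j + 1] lies outside the open intervals and is written as [2j + b] with
       [b = 1]. *)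
    destruct (Req_dec a (INR (2 * j) + 1)) as [e|ne].
    + exists j, 1; split; [lra|rewrite e; ring].
    + exfalso; apply nK; exists (S j); split; [lia|].
      rewrite mult_INR in *; rewrite S_INR; simpl (INR 2) in *; lra. }
destruct dec as [j [b [b01 E]]].
pose proof (psi_split q b (2 * j) q01) as S1; rewrite <- E, pow_1_even in S1.
pose proof (full_theta_ge_0 q b q01 b01) as F0.
pose proof (psi_shift q (1 - a) q01) as S2.
replace (1 - (1 - a)) with a in S2 by ring.
assert (half : 1 / 2 <= psi q (1 - a - 1)).
{ apply ptheta_ge_half; [now apply sqrt_in_01|].
  split; [apply Rlt_le, Rpower_pos|apply Rpower_le_1; lra]. }
pose proof (Rpower_pos q a).
set (e := Rpower q (- _)) in S1; assert (0 < e) by apply Rpower_pos.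
assert (0 <= e * full_theta q b) by (apply Rmult_le_pos; lra).
nra.
Qed.

(** * Strict monotonicity, limits and the zero *)

Lemma psi_incr (a q1 q2 : R) : Kdagger a -> 0 < q1 -> q1 < q2 -> q2 < 1 ->
  psi q1 a < psi q2 a.
Proof.
intros K q10 q12 q21; destruct (psi_split_Kdagger a K) as [a1 [b [c [b01 [c0 E]]]]].
rewrite !E by lra.
pose proof (psi_neg_decr q1 q2 a ltac:(lra) q21 ltac:(lra)).
pose proof (full_theta_decr q1 q2 b ltac:(lra) q21 ltac:(lra)).
pose proof (full_theta_pos q1 b ltac:(lra) b01).
pose proof (Rpower_pos q1 c).
(* Strictness comes from this factor, as [full_theta q1 b > 0]. *)
assert (Rpower q2 (- c) < Rpower q1 (- c)).
{ rewrite !Rpower_Ropp; apply Rinv_lt_contravar.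
  - apply Rmult_lt_0_compat; apply Rpower_pos.
  - apply Rlt_Rpower_l; lra. }
pose proof (Rpower_pos q2 (- c)); nra.
Qed.

Lemma psi_lim_0 (a : R) : Kdagger a ->
  filterlim (fun q => psi q a) (at_right 0) (Rbar_locally m_infty).
Proof.
intros K; destruct (psi_split_Kdagger a K) as [a1 [b [c [b01 [c0 E]]]]].
set (k := full_theta (1 / 2) b).
assert (k0 : 0 < k) by (apply full_theta_pos; lra).
intros P [M HM].
(* For [ln q < - L], [exp x >= 1 + x] gives [k q^(-c) >= k c L = |M| + 1], whereas the second
   summand of [psi q a] is at most [1/2]. *)
set (L := (Rabs M + 1) / (k * c)).
assert (d0 : 0 < Rmin (1 / 2) (exp (- L))) by (apply Rmin_glb_lt; [lra|apply exp_pos]).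
exists (mkposreal _ d0); intros q Hq q0.
apply Rabs_lt_between' in Hq; simpl in Hq.
pose proof (Rmin_l (1 / 2) (exp (- L))); pose proof (Rmin_r (1 / 2) (exp (- L))).
apply HM; rewrite E by lra.
pose proof (psi_neg_bounds q a ltac:(lra) ltac:(lra)) as [h _].
pose proof (full_theta_decr q (1 / 2) b ltac:(lra) ltac:(lra) ltac:(lra)) as f.
fold k in f.
assert (lnq : ln q < - L) by (rewrite <- (ln_exp (- L)); apply ln_increasing; lra).
assert (big : c * L <= Rpower q (- c)).
{ unfold Rpower; pose proof (exp_ineq1_le (- c * ln q)); nra. }
assert (kL : k * (c * L) = Rabs M + 1) by (unfold L; field; lra).
pose proof (Rle_abs (- M)) as AM; rewrite Rabs_Ropp in AM.
assert (k * (c * L) <= k * Rpower q (- c)) by (apply Rmult_le_compat_l; lra).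
pose proof (Rpower_pos q (- c)).
assert (k * Rpower q (- c) <= full_theta q b * Rpower q (- c))
  by (apply Rmult_le_compat_r; lra).
nra.
Qed.

(** Squeeze between [low], continuous at [1] with value [1/2], and the constant [1/2], which bounds
    above since the first summand is nonpositive. *)
Lemma psi_lim_1 (a : R) : Kdagger a ->
  filterlim (fun q => psi q a) (at_left 1) (locally (1 / 2)).
Proof.
intros K; destruct (psi_split_Kdagger a K) as [a1 [b [c [b01 [c0 E]]]]].
set (low := fun q => - Rpower q (- c) * ((1 - Rpower q b) * (1 - Rpower q (1 - b))) +
  (1 - / (1 + Rpower q a))).
apply (filterlim_le_le (F := at_left 1) low _ (fun _ => 1 / 2) (Finite (1 / 2))).
- exists (mkposreal _ Rlt_0_1); intros q Hq q1.
  apply Rabs_lt_between' in Hq; simpl in Hq.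
  rewrite E by lra; unfold low.
  pose proof (psi_neg_bounds q a ltac:(lra) ltac:(lra)).
  pose proof (full_theta_ge_0 q b ltac:(lra) ltac:(lra)).
  pose proof (full_theta_le q b ltac:(lra) ltac:(lra)).
  pose proof (Rpower_pos q (- c)); split; nra.
- assert (l1 : low 1 = 1 / 2).
  { unfold low, Rpower; rewrite ln_1, !Rmult_0_r, exp_0; field. }
  simpl; rewrite <- l1.
  eapply filterlim_filter_le_1; [apply filter_le_within|].
  apply (ex_derive_continuous (V := R_NormedModule) low 1).
  unfold low, Rpower; auto_derive; repeat split; try lra.
  apply Rgt_not_eq; pose proof (exp_pos (a * ln 1)); lra.
- apply filterlim_const.
Qed.

Lemma psi_root (a : R) : Kdagger a -> exists q, 0 < q < 1 /\ psi q a = 0.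
Proof.
intros K.
destruct (filter_ex (F := at_right 0) (fun q => psi q a < 0 /\ 0 < q < 1 / 2))
  as [q1 [neg q1b]].
{ apply filter_and.
  - apply (psi_lim_0 a K (fun y => y < 0)); now exists 0.
  - exists (mkposreal (1 / 2) ltac:(lra)); intros q Hq q0.
    apply Rabs_lt_between' in Hq; simpl in Hq; lra. }
(* Separating the two points by [1/2] gives [q1 < q2] for the intermediate value theorem. *)
destruct (filter_ex (F := at_left 1) (fun q => 0 < psi q a /\ 1 / 2 < q < 1))
  as [q2 [pos q2b]].
{ apply filter_and.
  - apply (psi_lim_1 a K (fun y => 0 < y)), (open_gt 0); lra.
  - exists (mkposreal (1 / 2) ltac:(lra)); intros q Hq q0.
    apply Rabs_lt_between' in Hq; simpl in Hq; lra. }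
destruct (IVT_interv (fun q => psi q a) q1 q2) as [q [qb q0]]; trivial; try lra.
- intros q Hq; apply continuity_pt_filterlim, psi_continuous; lra.
- exists q; split; [lra|easy].
Qed.

Theorem proposition13 :
  (forall a : R, Kdagger a ->
     (forall q1 q2 : R, 0 < q1 -> q1 < q2 -> q2 < 1 ->
        theta q1 (- Rpower q1 (- a)) < theta q2 (- Rpower q2 (- a))) /\
     filterlim (fun q : R => theta q (- Rpower q (- a)))
       (at_right 0) (Rbar_locally m_infty) /\
     filterlim (fun q : R => theta q (- Rpower q (- a)))
       (at_left 1) (locally (1 / 2))) /\
  (forall a : R, Kdagger a ->
     exists! q : R, (0 < q < 1) /\ theta q (- Rpower q (- a)) = 0) /\
  (forall a : R, 0 < a -> ~ Kdagger a ->
     ~ exists q : R, (0 < q < 1) /\ theta q (- Rpower q (- a)) = 0).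
Proof.
split; [|split].
- intros a K; split; [|split].
  + intros q1 q2 q10 q12 q21; rewrite !theta_psi by lra; now apply psi_incr.
  + apply filterlim_ext_loc with (2 := psi_lim_0 a K).
    exists (mkposreal 1 Rlt_0_1); intros q _ q0; now rewrite theta_psi.
  + apply filterlim_ext_loc with (2 := psi_lim_1 a K).
    exists (mkposreal 1 Rlt_0_1); intros q Hq _.
    apply Rabs_lt_between' in Hq; simpl in Hq; rewrite theta_psi; lra.
- intros a K; destruct (psi_root a K) as [q [q01 q0]]; exists q; split.
  + rewrite theta_psi; [easy|lra].
  + intros q' [q'01 q'0]; rewrite theta_psi in q'0 by lra.
    destruct (Rtotal_order q q') as [lt|[eq|gt]]; trivial.
    * pose proof (psi_incr a q q' K ltac:(lra) lt ltac:(lra)); lra.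
    * pose proof (psi_incr a q' q K ltac:(lra) gt ltac:(lra)); lra.
- intros a a0 nK [q [q01 q0]]; rewrite theta_psi in q0 by lra.
  now apply (psi_ne_0 q a).
Qed.
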